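(* Fix a recursive representation of the universal poset $\mathbb{P}=(\mathbb{N},\prec)$ on the natural numbers $\mathbb{N}$. No Martin-Löf randomizer of a recursive rational linear extension of $\mathbb{P}$ can be an automorphism of $\mathbb{P}$. That is, if $\eta$ is a recursive total order on $\mathbb{N}$ which is isomorphic to the standard ordering of the rational numbers and is a linear extension of $\mathbb{P}$, and if $\sigma\in S_\infty$ satisfies $\sigma\eta\in ML_\mu$, then $\sigma\notin\mathrm{Aut}(\mathbb{P})$.
   Context: The universal poset $\mathbb{P}$ is the Fraïssé limit of the class of finite posets: the countable homogeneous poset, unique up to isomorphism, into which every finite poset embeds (homogeneous: every isomorphism between finite substructures extends to an automorphism). A recursive representation of it on $\mathbb{N}$ is a copy of it with underlying set $\mathbb{N}$ whose strict order relation $\prec$ is a recursive (decidable) relation on $\mathbb{N}^2$. A linear extension of $\mathbb{P}$ is a total order $\xi$ on $\mathbb{N}$ such that $x\prec y$ implies $x<_\xi y$ for all $x,y\in\mathbb{N}$. A total order on $\mathbb{N}$ is recursive if it is a decidable relation, and rational if it is isomorphic to the standard ordering of the rational numbers. $\mathcal{M}$ is the set of (strict) total orders on $\mathbb{N}$, identified with a closed subset of the compact product space $\{0,1\}^{(\mathbb{N}\times\mathbb{N})_{\neq}}$, where $(\mathbb{N}\times\mathbb{N})_{\neq}$ is the set of pairs $(i,j)$ with $i\neq j$: a total order $<$ corresponds to $\xi$ with $\xi(x,y)=1\Leftrightarrow x<y$, and one writes $<_\xi$ for the order associated with $\xi$. $S_\infty$ is the group of all permutations of $\mathbb{N}$ with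 the topology of pointwise convergence; it acts continuously on $\mathcal{M}$ by $x<_{\sigma\xi}y\Leftrightarrow \sigma^{-1}x<_\xi\sigma^{-1}y$. The Glasner-Weiss measure $\mu$ is the unique $S_\infty$-invariant Borel probability measure on $\mathcal{M}$ (its existence and uniqueness are known). $\mathcal{M}_f$ is the set of total orders on finite subsets of $\mathbb{N}$. For $\ell\in\mathcal{M}_f$, the cylinder set $Z_\ell$ is the set of $\xi\in\mathcal{M}$ extending $\ell$. $\mathcal{Z}$ is the algebra of subsets of $\mathcal{M}$ generated by the sets $Z_\ell$, $\ell\in\mathcal{M}_f$. For a cylinder set $Z$ write $Z^1=Z$ and $Z^0=\mathcal{M}\setminus Z$. A recursive representation of $\mathcal{Z}$ is an enumeration $(T_i)_{i\in\mathbb{N}}$ of $\mathcal{Z}$ such that from a given $i$ one can effectively retrieve an expression of $T_i$ as a finite union of sets of the form $Z_{\ell_1}^{\delta_1}\cap\cdots\cap Z_{\ell_k}^{\delta_k}$ with each $\ell_j\in\mathcal{M}_f$ and $\delta_j\in\{0,1\}$. A set $A\subset\mathcal{M}$ is of constructive measure $0$ if, for some recursive representation $(T_i)_{i\in\mathbb{N}}$ of $\mathcal{Z}$, there is a total recursive $\phi:\mathbb{N}^2\to\mathbb{N}$ such that $A\subset\bigcap_n\bigcup_m T_{\phi(n,m)}$ and $\mu\left(\bigcup_m T_{\phi(n,m)}\right)$ converges effectively to $0$ as $n\to\infty$ (i.e. there is a total recursive $g$ such that this measure is $<2^{-k}$ for all $n\geq g(k)$). A total order $\xi\in\mathcal{M}$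 is $\mu$-Martin-Löf random if $\xi$ lies in the complement of every subset of $\mathcal{M}$ of constructive measure $0$; $ML_\mu$ denotes the set of $\mu$-Martin-Löf random total orders. For a recursive rational order $\eta$ on $\mathbb{N}$, a Martin-Löf randomizer of $\eta$ is a permutation in $S_\mu(\eta)=\{\sigma\in S_\infty:\sigma\eta\in ML_\mu\}$. *)

(* Defs.v *)
(* MathComp-Analysis *)
From HB Require Import structures.
From mathcomp Require Import all_boot all_order all_algebra.
From mathcomp Require Import all_classical all_reals all_analysis.

Set Implicit Arguments.
Unset Strict Implicit.
Unset Printing Implicit Defensive.

Import Order.TTheory GRing.Theory Num.Theory.

Local Open Scope classical_set_scope.

(* The class of total recursive functions: the zero, successor and projection
   functions, closed under composition, primitive recursion, and minimization
   applied to regular functions, that is, when a zero exists for all values of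
   the parameters. The recursion and minimization variables come first. *)
Inductive recursive : forall n : nat, (n.-tuple nat -> nat) -> Prop :=
| rec_zero n : @recursive n (fun _ => 0)
| rec_succ : @recursive 1 (fun t => (tnth t ord0).+1)
| rec_proj n (i : 'I_n) : @recursive n (fun t => tnth t i)
| rec_comp n m (f : m.-tuple nat -> nat) (g : 'I_m -> n.-tuple nat -> nat) :
    recursive f -> (forall i, recursive (g i)) ->
    @recursive n (fun t => f [tuple g i t | i < m])
| rec_prec n (f : n.-tuple nat -> nat) (g : n.+2.-tuple nat -> nat)
    (h : n.+1.-tuple nat -> nat) :
    recursive f -> recursive g ->
    (forall t : n.-tuple nat, h [tuple of 0 :: t] = f t) ->
    (forall k (t : n.-tuple nat), h [tuple of k.+1 :: t] =
                 g [tuple of k :: h [tuple of k :: t] :: t]) ->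
    recursive h
| rec_min n (f : n.+1.-tuple nat -> nat) (h : n.-tuple nat -> nat) :
    recursive f ->
    (forall t : n.-tuple nat, f [tuple of h t :: t] = 0) ->
    (forall (t : n.-tuple nat) k, k < h t -> f [tuple of k :: t] <> 0) ->
    recursive h.

Definition recursive1 (f : nat -> nat) : Prop :=
  @recursive 1 (fun t => f (tnth t ord0)).

Definition recursive2 (f : nat -> nat -> nat) : Prop :=
  @recursive 2 (fun t => f (tnth t ord0) (tnth t ord_max)).

Definition recursive_rel (r : rel nat) : Prop :=
  recursive2 (fun x y => nat_of_bool (r x y)).

Notation Sinf := {splitbij [set: nat] >-> [set: nat]}.

Definition automorphism (r : rel nat) (s : Sinf) : Prop :=
  forall x y, r (s x) (s y) = r x y.

(* [prec] is a copy with underlying set nat of the universal poset. *)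
Record universal_poset (prec : rel nat) : Prop := UniversalPoset {
  up_irr : irreflexive prec;
  up_trans : transitive prec;
  up_embeds : forall (d : Order.disp_t) (T : finPOrderType d),
    exists f : T -> nat,
      injective f /\ forall x y : T, prec (f x) (f y) = (x < y)%O;
  up_homogeneous : forall (A B : set nat) (f : nat -> nat),
    finite_set A -> finite_set B -> set_bij A B f ->
    (forall x y, A x -> A y -> prec (f x) (f y) = prec x y) ->
    exists s : Sinf, automorphism prec s /\ forall x, A x -> s x = f x }.

Record total_order : Type := TotalOrder {
  tlt :> rel nat;
  tlt_irr : irreflexive tlt;
  tlt_trans : transitive tlt;
  tlt_total : forall x y, x != y -> tlt x y || tlt y x }.

HB.instance Definition _ := gen_eqMixin total_order.
HB.instance Definition _ := gen_choiceMixin total_order.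

Definition standard_order : total_order.
Proof.
apply: (@TotalOrder (fun x y => x < y)).
- exact: ltnn.
- exact: ltn_trans.
- by move=> x y; rewrite neq_ltn.
Defined.

HB.instance Definition _ := isPointed.Build total_order standard_order.

Definition offdiag : Type := {p : nat * nat | p.1 != p.2}.

Definition order_code (xi : total_order) : {ptws offdiag -> bool} :=
  fun p => xi (val p).1 (val p).2.

(* The topology of total orders as a subspace of the product space. *)
HB.instance Definition _ :=
  Topological.copy total_order (initial_topology order_code).

Notation borel_order := (g_sigma_algebraType (@open total_order)).

Definition act_rel (s : Sinf) (xi : total_order) : rel nat :=
  fun x y => xi (s^-1%FUN x) (s^-1%FUN y).

Lemma act_irr s xi : irreflexive (act_rel s xi).
Proof. by move=> x; exact: tlt_irr. Qed.

Lemma act_trans s xi : transitive (act_rel s xi).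
Proof. by move=> y x z; exact: tlt_trans. Qed.

Lemma act_total s xi x y : x != y -> act_rel s xi x y || act_rel s xi y x.
Proof.
move=> xy; apply: tlt_total; apply: contra xy => /eqP sxy; apply/eqP.
have sK z : s (s^-1%FUN z) = z by apply: invK; rewrite inE.
by rewrite -(sK x) sxy sK.
Qed.

Definition act (s : Sinf) (xi : total_order) : total_order :=
  TotalOrder (@act_irr s xi) (@act_trans s xi) (@act_total s xi).

(* There is exactly one invariant Borel probability measure, so this
   property characterizes the Glasner-Weiss measure. *)
Definition glasner_weiss (R : realType) (mu : probability borel_order R) :
    Prop :=
  forall (s : Sinf) (A : set borel_order),
    measurable A -> mu (act s @^-1` A) = mu A.

(* A total order on a finite set of natural numbers is represented by the
   duplicate-free list of its elements in increasing order. *)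
Definition fin_order : Type := {l : seq nat | uniq l}.

Definition fin_lt (l : fin_order) : rel nat :=
  fun x y => [&& x \in val l, y \in val l & index x (val l) < index y (val l)].

Definition cylinder (l : fin_order) : set total_order :=
  [set xi : total_order | forall x y, fin_lt l x y -> xi x y].

Definition set_algebra (T : Type) (G : set (set T)) : Prop :=
  [/\ G set0, setU_closed G & setC_closed G].

Definition cylinder_algebra : set (set total_order) :=
  smallest (@set_algebra total_order) (range cylinder).

(* Formal finite unions of finite intersections of literals; (l, true) stands
   for the cylinder of l and (l, false) for its complement. *)
Definition cyl_expr : Type := seq (seq (fin_order * bool)).

Definition literal_set (p : fin_order * bool) : set total_order :=
  if p.2 then cylinder p.1 else ~` cylinder p.1.

Definition expr_set (e : cyl_expr) : set total_order :=
  \big[setU/set0]_(c <- e) \big[setI/setT]_(p <- c) literal_set p.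

(* CodeSeq.code is an effective bijection from seq nat to nat. *)
Definition literal_code (p : fin_order * bool) : nat :=
  CodeSeq.code (nat_of_bool p.2 :: val p.1).

Definition expr_code (e : cyl_expr) : nat :=
  CodeSeq.code [seq CodeSeq.code [seq literal_code p | p <- c] | c <- e].

Definition recursive_representation (T : nat -> set total_order) : Prop :=
  range T = cylinder_algebra /\
  exists e : nat -> cyl_expr,
    (forall i, expr_set (e i) = T i) /\ recursive1 (expr_code \o e).

Definition constructive_null (R : realType) (mu : probability borel_order R)
    (A : set total_order) : Prop :=
  exists T : nat -> set total_order, recursive_representation T /\
  exists phi : nat -> nat -> nat, recursive2 phi /\
    A `<=` \bigcap_n \bigcup_m T (phi n m) /\
    exists g : nat -> nat, recursive1 g /\
      forall k n, g k <= n ->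
        (mu (\bigcup_m T (phi n m)) < ((2%:R ^- k)%R : R)%:E)%E.

Definition ML (R : realType) (mu : probability borel_order R) :
    set total_order :=
  [set xi | forall A, constructive_null mu A -> (~` A) xi].

Definition randomizers (R : realType) (mu : probability borel_order R)
    (eta : total_order) : set Sinf :=
  [set s | ML mu (act s eta)].

Definition linear_extension (prec : rel nat) (xi : total_order) : Prop :=
  forall x y, prec x y -> xi x y.

Definition rational_order (xi : total_order) : Prop :=
  exists f : nat -> rat, bijective f /\ forall x y, xi x y = (f x < f y)%R.

(* Main.v *)
Require Import Defs.
From mathcomp Require Import all_boot all_order all_algebra.
From mathcomp Require Import all_classical all_reals all_analysis.
From mathcomp Require Import zify.

(** An automorphism [sigma] of the poset maps a linear extension [eta] to a
    linear extension: if [x] precedes [y] then [sigma^-1 x] precedes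
    [sigma^-1 y], hence [x] is below [y] in [sigma eta]
    ([linear_extension_act]). It therefore suffices that the set of all linear
    extensions has constructive measure 0
    ([constructive_null_linear_extensions]).

    Every element [x] of the universal poset is below some numerically larger
    one: move the bottom of a chain of [x + 2] elements to [x] by homogeneity;
    one of its members exceeds [x] ([exists_gap]). Searching for the least
    such element and iterating gives a recursive, strictly increasing sequence
    [chain] that ascends in the poset. A linear extension makes
    [chain 0 < ... < chain n]; in particular [chain n] is the maximum of these
    [n + 1] elements. By invariance under transpositions each of the [n + 1]
    elements is the maximum with the same probability, and these events are
    disjoint, so this has measure at most [1 / (n + 1)]
    ([measure_ascending]). This is below [2 ^ - k] as soon as [n >= 2 ^ k].

    What remains is to present these events effectively, that is, to give a
    recursive representation of the cylinder algebra for which an index of the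
    [n]-th event is a recursive function of [n]. Validity tests on codes are
    avoided by using only the atoms [x < x + d + 1] and their negations, one
    for each triple of numbers: a number then codes a sequence of sequences of
    atoms with no condition at all, and is read as a disjunctive normal form
    ([dnf]). The negation of [x < y] is [y < x], so these formulas define
    every cylinder, and they are closed under the Boolean operations
    ([representation_dnf]). The passage from an index to the code of its
    expression maps a recursive function over a coded sequence of coded
    sequences, which is recursive by [recursive1_map]. *)

Set Implicit Arguments.
Unset Strict Implicit.
Unset Printing Implicit Defensive.

Import Order.TTheory GRing.Theory Num.Theory.
Import CodeSeq.
Local Open Scope classical_set_scope.

(** * Recursive functions *)

Lemma eq_recursive n (f g : n.-tuple nat -> nat) :
  f =1 g -> recursive f -> recursive g.
Proof. by move=> /funext ->. Qed.

Lemma recursive_nth n i : i < n -> @recursive n (fun t => nth 0 t i).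
Proof.
move=> ltin; apply: eq_recursive (rec_proj (Ordinal ltin)) => t.
by rewrite (tnth_nth 0).
Qed.

Section Composition.
Variable n : nat.
Implicit Types g : n.-tuple nat -> nat.

Lemma recursive_comp1 f g :
  recursive1 f -> recursive g -> recursive (fun t => f (g t)).
Proof.
move=> rf rg; apply: eq_recursive (rec_comp rf (fun=> rg)) => t.
by rewrite tnth_mktuple.
Qed.

Lemma recursive_comp2 f g1 g2 : recursive2 f -> recursive g1 ->
  recursive g2 -> recursive (fun t => f (g1 t) (g2 t)).
Proof.
move=> rf r1 r2; pose g (i : 'I_2) := if i == ord0 then g1 else g2.
have rg i : recursive (g i) by rewrite /g; case: ifP.
by apply: eq_recursive (rec_comp rf rg) => t; rewrite !tnth_mktuple.
Qed.

Lemma recursive_const c : @recursive n (fun=> c).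
Proof.
elim: c => [|c IHc]; first exact: rec_zero.
exact: (@recursive_comp1 succn _ rec_succ IHc).
Qed.

End Composition.

Lemma recursive1_nth f :
  @recursive 1 (fun t => f (nth 0 t 0)) -> recursive1 f.
Proof. by apply: eq_recursive => t; rewrite (tnth_nth 0). Qed.

Lemma recursive2_nth f :
  @recursive 2 (fun t => f (nth 0 t 0) (nth 0 t 1)) -> recursive2 f.
Proof. by apply: eq_recursive => t; rewrite !(tnth_nth 0). Qed.

Lemma recursive1_prec c g h : recursive2 g ->
  h 0 = c -> (forall k, h k.+1 = g k (h k)) -> recursive1 h.
Proof.
move=> rg h0 hS; apply: (rec_prec (recursive_const 0 c) rg) => [t|k t].
- by rewrite (tnth_nth 0).
- by rewrite !(tnth_nth 0) /= hS.
Qed.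

Lemma recursive2_prec f g h : recursive1 f ->
  @recursive 3 (fun t => g (nth 0 t 0) (nth 0 t 1) (nth 0 t 2)) ->
  (forall y, h 0 y = f y) -> (forall k y, h k.+1 y = g k (h k y) y) ->
  recursive2 h.
Proof.
move=> rf rg h0 hS; apply: (rec_prec rf rg) => [t|k t].
- by rewrite !(tnth_nth 0) /= h0.
- by rewrite !(tnth_nth 0) /= hS.
Qed.

Lemma recursive1_min f h : recursive2 f -> (forall y, f (h y) y = 0) ->
  (forall y k, k < h y -> f k y <> 0) -> recursive1 h.
Proof.
move=> rf f0 fmin; apply: (rec_min rf) => [t|t k].
- by rewrite !(tnth_nth 0) /= f0.
- by rewrite !(tnth_nth 0) /=; exact: fmin.
Qed.

Lemma recursive1S : recursive1 succn.
Proof. exact: rec_succ. Qed.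

Lemma recursive2_addn : recursive2 addn.
Proof.
apply: (@recursive2_prec id (fun _ r _ => r.+1)) => //.
- exact/recursive1_nth/recursive_nth.
- exact/(recursive_comp1 recursive1S)/recursive_nth.
Qed.

Lemma recursive1_is0 : recursive1 (fun n => n == 0).
Proof.
apply: (@recursive1_prec 1 (fun _ _ => 0)) => //.
exact/recursive2_nth/recursive_const.
Qed.

Lemma recursive1_double : recursive1 double.
Proof.
apply: recursive1_nth.
apply: (eq_recursive (f := fun t => nth 0 t 0 + nth 0 t 0)).
  by move=> t; rewrite addnn.
by apply: (recursive_comp2 recursive2_addn); exact: recursive_nth.
Qed.

Lemma recursive1_odd : recursive1 (fun n => odd n).
Proof.
apply: (@recursive1_prec 0 (fun _ r => r == 0)) => //.
- exact/recursive2_nth/(recursive_comp1 recursive1_is0)/recursive_nth.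
- by move=> k /=; case: (odd k).
Qed.

Lemma recursive1_half : recursive1 half.
Proof.
apply: (@recursive1_prec 0 (fun k r => odd k + r)) => //.
- apply/recursive2_nth/(recursive_comp2 recursive2_addn).
  + exact/(recursive_comp1 recursive1_odd)/recursive_nth.
  + exact: recursive_nth.
- by move=> k; rewrite -uphalf_half.
Qed.

Lemma recursive2_iter f : recursive1 f -> recursive2 (fun k x => iter k f x).
Proof.
move=> rf; apply: (@recursive2_prec id (fun _ r _ => f r)) => //.
- exact/recursive1_nth/recursive_nth.
- exact/(recursive_comp1 rf)/recursive_nth.
Qed.

(** Case distinctions are expressed by sums of guarded terms. *)
Lemma recursive2_guard : recursive2 (fun u x => if u is 0 then 0 else x).
Proof.
apply: (@recursive2_prec (fun=> 0) (fun _ _ x => x)) => //.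
- exact/recursive1_nth/recursive_const.
- exact: recursive_nth.
Qed.

(** * Codes of sequences *)

Lemma code0_cons s : code (0 :: s) = (code s).*2.+1.
Proof. exact: mul1n. Qed.

Lemma code_cons_neq0 n s : (code (n :: s) == 0) = false.
Proof. by rewrite /= muln_eq0 expn_eq0. Qed.

Lemma recursive2_cons : recursive2 (fun n c => code (n :: decode c)).
Proof.
apply: (@recursive2_prec (fun c => c.*2.+1) (fun _ r _ => r.*2)).
- apply/recursive1_nth/(recursive_comp1 recursive1S).
  exact/(recursive_comp1 recursive1_double)/recursive_nth.
- exact/(recursive_comp1 recursive1_double)/recursive_nth.
- by move=> c; rewrite code0_cons decodeK.
- by move=> n c; rewrite /= -[in RHS]mul2n mulnA expnS.
Qed.

Lemma iter_half_code k n s : k <= n ->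
  iter k half (code (n :: s)) = code (n - k :: s).
Proof.
elim: k => [|k IHk] ltkn; first by rewrite subn0.
rewrite iterS IHk ?(ltnW ltkn)// -(subnSK ltkn) /=.
by rewrite expnS -mulnA mul2n doubleK.
Qed.

(** The head of a nonempty sequence is the 2-adic valuation of its code. *)
Lemma recursive1_head : recursive1 (fun c => head 0 (decode c)).
Proof.
apply: (@recursive1_min
  (fun k c => (odd (iter k half c) + (c == 0) == 0 : nat))).
- apply/recursive2_nth/(recursive_comp1 recursive1_is0).
  apply: (recursive_comp2 recursive2_addn).
  + apply: (recursive_comp1 recursive1_odd).
    by apply: (recursive_comp2 (recursive2_iter recursive1_half));
      exact: recursive_nth.
  + exact/(recursive_comp1 recursive1_is0)/recursive_nth.
- move=> c; rewrite -(decodeK c) codeK; case: (decode c) => // n s.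
  by rewrite [head _ _]/= iter_half_code// subnn code0_cons /= odd_double.
- move=> c k; rewrite -(decodeK c) codeK; case: (decode c) => // n s.
  rewrite [head _ _]/= => ltkn; rewrite iter_half_code 1?ltnW//.
  rewrite -(subnSK ltkn) /= expnS -mulnA mul2n odd_double.
  by rewrite !muln_eq0 expn_eq0.
Qed.

Lemma recursive1_behead : recursive1 (fun c => code (behead (decode c))).
Proof.
apply: recursive1_nth; apply: (eq_recursive (f := fun t : 1.-tuple nat =>
  half (iter (head 0 (decode (nth 0 t 0))) half (nth 0 t 0)))) => [t|].
  rewrite -[X in iter _ _ X](decodeK (nth 0 t 0)).
  case: (decode (nth 0 t 0)) => // n s.
  by rewrite [head _ _]/= iter_half_code// subnn code0_cons /= uphalf_double.
apply: (recursive_comp1 recursive1_half).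
apply: (recursive_comp2 (recursive2_iter recursive1_half)).
- exact/(recursive_comp1 recursive1_head)/recursive_nth.
- exact: recursive_nth.
Qed.

Lemma recursive2_drop : recursive2 (fun k c => code (drop k (decode c))).
Proof.
apply: recursive2_nth; apply: (eq_recursive (f := fun t : 2.-tuple nat =>
  iter (nth 0 t 0) (fun c => code (behead (decode c))) (nth 0 t 1))) => [t|].
  elim: (nth 0 t 0) => [|k IHk]; first by rewrite drop0 decodeK.
  by rewrite iterS IHk codeK -drop1 drop_drop add1n.
by apply: (recursive_comp2 (recursive2_iter recursive1_behead));
  exact: recursive_nth.
Qed.

Lemma recursive1_nth_decode i : recursive1 (fun c => nth 0 (decode c) i).
Proof.
apply: recursive1_nth; apply: (eq_recursive (f := fun t : 1.-tuple nat =>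
  head 0 (decode (code (drop i (decode (nth 0 t 0))))))) => [t|].
  by rewrite codeK -nth0 nth_drop addn0.
apply: (recursive_comp1 recursive1_head).
apply: (recursive_comp2 recursive2_drop); first exact: recursive_const.
exact: recursive_nth.
Qed.

Lemma size_decode c : size (decode c) <= c.
Proof.
rewrite -[leqRHS]decodeK; elim: (decode c) => //= n s.
have: 0 < 2 ^ n by rewrite expn_gt0.
nia.
Qed.

(** Primitive recursion on the length of a treated prefix accumulates the
    images of its entries in reverse order; the code itself bounds the length
    of the sequence. *)
Lemma recursive1_rev_map f :
  recursive1 f -> recursive1 (fun c => code (rev (map f (decode c)))).
Proof.
move=> rf; pose suf k c := code (drop k (decode c)).
pose h k c := code (rev (map f (take k (decode c)))).
pose g k r c := (if suf k c is 0 then 0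
                 else code (f (head 0 (decode (suf k c))) :: decode r))
              + (if (suf k c == 0 : nat) is 0 then 0 else r).
have rsuf : @recursive 3 (fun t => suf (nth 0 t 0) (nth 0 t 2)).
  by apply: (recursive_comp2 recursive2_drop); exact: recursive_nth.
have rh : recursive2 h.
  apply: (@recursive2_prec (fun=> 0) g).
  - exact/recursive1_nth/recursive_const.
  - apply: (recursive_comp2 recursive2_addn).
    + apply: (recursive_comp2 recursive2_guard rsuf).
      apply: (recursive_comp2 recursive2_cons); last exact: recursive_nth.
      exact/(recursive_comp1 rf)/(recursive_comp1 recursive1_head).
    + apply: (recursive_comp2 recursive2_guard); last exact: recursive_nth.
      exact: (recursive_comp1 recursive1_is0).
  - by move=> c; rewrite /h take0.
  - move=> k c; rewrite /h /g /suf.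
    have [ltk|lek] := ltnP k (size (decode c)); last first.
      by rewrite drop_oversize//= !take_oversize// 1?leqW.
    rewrite codeK (take_nth 0)// map_rcons rev_rcons codeK.
    rewrite (drop_nth 0)// [head _ _]/=.
    by case: (code _) (code_cons_neq0 (nth 0 (decode c) k)
      (drop k.+1 (decode c))) => //= p _; rewrite addn0.
apply: recursive1_nth; apply: (eq_recursive (f := fun t : 1.-tuple nat =>
  h (nth 0 t 0) (nth 0 t 0))) => [t|].
  by rewrite /h take_oversize ?size_decode.
by apply: (recursive_comp2 rh); exact: recursive_nth.
Qed.

Lemma recursive1_map f :
  recursive1 f -> recursive1 (fun c => code (map f (decode c))).
Proof.
move=> rf; apply: recursive1_nth.
apply: (eq_recursive (f := fun t : 1.-tuple nat =>
  code (rev (map id (decode (code (rev (map f (decode (nth 0 t 0))))))))))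
  => [t|]; first by rewrite codeK map_id revK.
apply: (recursive_comp1 (recursive1_rev_map _)).
- exact/recursive1_nth/recursive_nth.
- exact/(recursive_comp1 (recursive1_rev_map rf))/recursive_nth.
Qed.

(** * A recursive representation of the cylinder algebra *)

Lemma uniq_pair x d : uniq [:: x; x + d.+1].
Proof. by rewrite /= inE andbT; lia. Qed.

(** Writing the second element as [x + d + 1] makes every pair of numbers
    [(x, d)] a legitimate argument. *)
Definition pair_order x d : fin_order :=
  exist (fun l => uniq l) [:: x; x + d.+1] (uniq_pair x d).

(** A number is read as the sequence [x; d; b; ...], with missing entries 0;
    [b = 0] selects the positive literal. *)
Definition literal (t : nat) : fin_order * bool :=
  (pair_order (nth 0 (decode t) 0) (nth 0 (decode t) 1),
   nth 0 (decode t) 2 == 0).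

Definition clause (c : nat) := map literal (decode c).

Definition dnf (i : nat) : cyl_expr := map clause (decode i).

(** Boolean truth of [literal t] in [xi]: the connectives of formulas then act
    on Booleans instead of sets. *)
Definition holds (xi : total_order) (t : nat) : bool :=
  let: x := nth 0 (decode t) 0 in
  xi x (x + (nth 0 (decode t) 1).+1) == (nth 0 (decode t) 2 == 0).

Lemma holds_pair xi x d : holds xi (code [:: x; d]) = xi x (x + d.+1).
Proof. by rewrite /holds codeK /= eqb_id. Qed.

Lemma cylinder_pair x d xi :
  cylinder (pair_order x d) xi <-> xi x (x + d.+1).
Proof.
have ne : (x == x + d.+1) = false by lia.
rewrite /cylinder /fin_lt /=; split=> [|xixy y z].
  by apply; rewrite !inE !eqxx orbT /= ne.
rewrite !inE => /and3P[/orP[]/eqP-> /orP[]/eqP->] /=; rewrite ?eqxx ?ltnn// ne.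
Qed.

Lemma literal_setP t xi : literal_set (literal t) xi <-> holds xi t.
Proof.
rewrite /literal_set /holds /=; case: eqP => _ /=; rewrite ?eqb_id.
  exact: cylinder_pair.
rewrite eqbF_neg; split=> [nx|/negP nx /cylinder_pair//].
by apply/negP => /cylinder_pair.
Qed.

Lemma expr_setP (e : cyl_expr) xi : expr_set e xi <->
  exists2 c, List.In c e & forall p, List.In p c -> literal_set p xi.
Proof.
have clauseP (c : seq (fin_order * bool)) :
    (\big[setI/setT]_(p <- c) literal_set p) xi <->
    forall p, List.In p c -> literal_set p xi.
  elim: c => [|p c IHc]; first by rewrite big_nil.
  rewrite big_cons; split=> [[pxi /IHc cxi] q [<-//|]|H]; first exact: cxi.
  by split; [apply: H; left | apply/IHc => q qc; apply: H; right].
rewrite /expr_set; elim: e => [|c e IHe].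
  by rewrite big_nil; split=> [[]|[]].
rewrite big_cons; split=> [[/clauseP cxi|/IHe[d de dxi]]|[d [<-|de] dxi]].
- by exists c => //; left.
- by exists d => //; right.
- by left; apply/clauseP.
- by right; apply/IHe; exists d.
Qed.

(** No test occurs on the way from an index to the code of its expression, only
    two nested maps of a recursive function on literals. *)
Lemma recursive1_dnf : recursive1 (expr_code \o dnf).
Proof.
pose lit_code t := code (nat_of_bool (nth 0 (decode t) 2 == 0) ::
  decode (code (nth 0 (decode t) 0 :: decode (code
   (nth 0 (decode t) 0 + (nth 0 (decode t) 1).+1 :: decode 0))))).
have rlit : recursive1 lit_code.
  have r i : @recursive 1 (fun t => nth 0 (decode (nth 0 t 0)) i).
    exact/(recursive_comp1 (recursive1_nth_decode i))/recursive_nth.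
  apply: recursive1_nth; apply: (recursive_comp2 recursive2_cons).
    exact: (recursive_comp1 recursive1_is0).
  apply: (recursive_comp2 recursive2_cons) => //.
  apply: (recursive_comp2 recursive2_cons); last exact: recursive_const.
  apply: (recursive_comp2 recursive2_addn) => //.
  exact: (recursive_comp1 recursive1S).
apply: recursive1_nth; apply: eq_recursive (recursive_comp1
  (recursive1_map (recursive1_map rlit)) (recursive_nth (ltn0Sn 0))) => t.
rewrite /= /expr_code /dnf -map_comp; congr code; apply: eq_map => c /=.
rewrite /clause -map_comp; congr code; apply: eq_map => u /=.
by rewrite /lit_code /literal_code !codeK.
Qed.

Definition satisfies (s : seq (seq nat)) xi := has (all (holds xi)) s.

Lemma expr_set_dnf s xi :
  expr_set (dnf (code (map code s))) xi <-> satisfies s xi.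
Proof.
rewrite expr_setP /dnf codeK -map_comp /satisfies.
elim: s => [|c s IHs] /=; first by split=> [[]|].
have cP : (forall p, List.In p (clause (code c)) -> literal_set p xi) <->
    all (holds xi) c.
  rewrite /clause codeK; elim: c {IHs} => [|t c IHc] //=.
  split=> [H|/andP[/literal_setP tx /IHc H p [<-//|/H//]]].
  apply/andP; split; first by apply/literal_setP/H; left.
  by apply/IHc => p pc; apply: H; right.
split=> [[d [<-|ds] dxi]|/orP[/cP cx|/IHs[d ds dxi]]].
- by apply/orP; left; apply/cP.
- by apply/orP; right; apply/IHs; exists d.
- by exists (clause (code c)) => //; left.
- by exists d => //; right.
Qed.

(** Decoding is onto, so that indices of the form below exhaust all formulas. *)
Lemma dnf_surj i : exists s, dnf i = dnf (code (map code s)).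
Proof.
exists (map decode (decode i)); rewrite -map_comp.
rewrite [map _ _](@eq_map _ _ _ id) ?map_id ?decodeK// => c /=.
by rewrite decodeK.
Qed.

Definition definable (A : set total_order) :=
  exists s, forall xi, A xi <-> satisfies s xi.

Lemma range_dnf : range (expr_set \o dnf) = definable.
Proof.
apply/seteqP; split=> [_ [i _ <-]|A [s As]].
  have [s is_] := dnf_surj i; exists s => xi.
  by rewrite /= is_; exact: expr_set_dnf.
exists (code (map code s)) => //; apply/seteqP.
by split=> xi; rewrite /= expr_set_dnf As.
Qed.

Lemma holds_neg t : exists t', forall xi, holds xi t' = ~~ holds xi t.
Proof.
exists (code [:: nth 0 (decode t) 0; nth 0 (decode t) 1;
  nat_of_bool (nth 0 (decode t) 2 == 0)]) => xi.
by rewrite /holds codeK /=; case: (xi _ _); case: (nth _ _ 2 == 0).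
Qed.

Lemma definableI A B : definable A -> definable B -> definable (A `&` B).
Proof.
move=> [s As] [s' Bs']; exists [seq c ++ c' | c <- s, c' <- s'] => xi.
rewrite /setI /= As Bs' /satisfies; split.
  move=> [/hasP[c cs cx] /hasP[c' cs' cx']]; apply/hasP.
  by exists (c ++ c'); [apply/allpairsP; exists (c, c') | rewrite all_cat cx].
move=> /hasP[_ /allpairsP[[c c'] /= [cs cs' ->]]]; rewrite all_cat.
by move=> /andP[cx cx']; split; apply/hasP; [exists c|exists c'].
Qed.

Lemma definableU A B : definable A -> definable B -> definable (A `|` B).
Proof.
move=> [s As] [s' Bs']; exists (s ++ s') => xi.
by rewrite /setU /= As Bs' /satisfies has_cat; split=> /orP.
Qed.

Lemma definableC A : definable A -> definable (~` A).
Proof.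
move=> [s As]; have {A As}-> : A = [set xi | satisfies s xi].
  by apply/seteqP; split=> xi /As.
elim: s => [|c s IHs]; first by exists [:: [::]] => xi; split.
have -> : ~` [set xi | satisfies (c :: s) xi] =
    ~` [set xi | all (holds xi) c] `&` ~` [set xi | satisfies s xi].
  by rewrite -setCU; congr (~` _); apply/seteqP; split=> xi /= /orP.
apply: definableI => // {s IHs}; elim: c => [|t c IHc].
  by exists [::] => xi; split=> // /(_ isT).
have -> : ~` [set xi | all (holds xi) (t :: c)] =
    ~` [set xi | holds xi t] `|` ~` [set xi | all (holds xi) c].
  by rewrite -setCI; congr (~` _); apply/seteqP; split=> xi /= /andP.
apply: definableU => //; have [t' tP] := holds_neg t.
exists [:: [:: t']] => xi; rewrite /satisfies /= orbF andbT tP.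
by split=> /negP.
Qed.

(** Literals speak of [x < y] only for [x] numerically smaller than [y]; by
    totality the other case is a negation. *)
Lemma definable_lt x y : x != y -> definable [set xi : total_order | xi x y].
Proof.
move=> nxy; wlog ltxy : x y nxy / x < y => [H|].
  have [ltxy|ltyx|eqxy] := ltngtP x y; [exact: H| |by case/eqP: nxy].
  have -> : [set xi : total_order | xi x y] =
      ~` [set xi : total_order | xi y x].
    apply/seteqP; split=> xi /=.
      by move=> xy yx; have := tlt_irr xi x; rewrite (tlt_trans xy yx).
    by move: (tlt_total xi nxy) => /orP[].
  by apply/definableC/H; rewrite 1?eq_sym.
exists [:: [:: code [:: x; y - x.+1]]] => xi.
rewrite /satisfies [has _ _]orbF [all _ _]andbT holds_pair.
by have -> : x + (y - x.+1).+1 = y by lia.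
Qed.

(** A cylinder is the intersection of the comparisons that it prescribes. *)
Lemma definable_cylinder l : definable (cylinder l).
Proof.
have bigP (P : {pred nat * nat}) (r : seq (nat * nat)) :
    {in r, forall p, P p -> p.1 != p.2} ->
    definable [set xi : total_order | {in r, forall p, P p -> xi p.1 p.2}].
  elim: r => [|p r IHr] ne; first by exists [:: [::]] => xi; split.
  have {}IHr : definable [set xi : total_order |
      {in r, forall p, P p -> xi p.1 p.2}].
    by apply: IHr => q qr; apply: ne; rewrite inE qr orbT.
  have [Pp|nPp] := boolP (P p); last first.
    have [s sP] := IHr; exists s => xi; rewrite -sP; split=> H q.
      by move=> qr; apply: H; rewrite inE qr orbT.
    by rewrite inE => /predU1P[->|/H//]; rewrite (negPf nPp).
  have np : p.1 != p.2 by apply: ne => //; rewrite inE eqxx.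
  have [s sP] := definableI (definable_lt np) IHr; exists s => xi.
  rewrite -sP; split=> [H|[xp H] q].
    by split=> [|q qr]; apply: H; rewrite // inE ?eqxx// qr orbT.
  by rewrite inE => /predU1P[->|/H].
have [|s sP] := bigP (fun p => fin_lt l p.1 p.2)
    [seq (x, y) | x <- val l, y <- val l].
  move=> [x y] _ /= /and3P[_ _]; apply: contraTneq => ->.
  by rewrite ltnn.
exists s => xi; rewrite -sP; split=> [H [x y] _ /H//|H x y lxy].
apply: (H (x, y)) => //; apply/allpairsP; exists (x, y).
by case/and3P: lxy.
Qed.

Lemma representation_dnf : recursive_representation (expr_set \o dnf).
Proof.
split; last by exists dnf; split=> //; exact: recursive1_dnf.
rewrite range_dnf; apply/seteqP; split; last first.
  apply: smallest_sub => [|_ [l _ <-]]; last exact: definable_cylinder.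
  split; first by exists [::] => xi; split.
  - by move=> A B; exact: definableU.
  - by move=> A; exact: definableC.
rewrite -range_dnf => _ [i _ <-] G [[G0 GU GC] Gcyl] /=.
have GT : G setT by rewrite -setC0; exact: GC.
have GI A B : G A -> G B -> G (A `&` B).
  by move=> GA GB; rewrite -[_ `&` _]setCK setCI; apply/GC/GU; exact: GC.
rewrite /expr_set; elim: (dnf i) => [|c e IHe]; first by rewrite big_nil.
rewrite big_cons; apply: GU => //; elim: c => [|[l b] c IHc].
  by rewrite big_nil.
rewrite big_cons; apply: GI => //.
have Gl : G (cylinder l) by apply: Gcyl; exists l.
by rewrite /literal_set; case: b => //; exact: GC.
Qed.

(** * Invariant measures of initial segments of a chain *)

(** Off the diagonal this is the preimage of an open set by a coordinate
    projection. *)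
Lemma measurable_lt x y :
  measurable ([set xi : total_order | xi x y] : set borel_order).
Proof.
have [->|nxy] := eqVneq x y.
  have -> : [set xi : total_order | xi y y] = set0.
    by apply/seteqP; split=> xi //=; rewrite tlt_irr.
  exact: measurable0.
apply: sub_sigma_algebra.
pose p : offdiag :=
  exist (fun p : nat * nat => is_true (p.1 != p.2)) (x, y) nxy.
exists ((fun f : {ptws offdiag -> bool} => f p) @^-1` [set true]) => //.
apply: open_comp; last exact: discrete_open.
by move=> + _; exact: (@proj_continuous offdiag (fun=> bool) p).
Qed.

Definition maximum (X : seq nat) (x : nat) : set total_order :=
  [set xi : total_order | forall y, y \in X -> y != x -> xi y x].

Lemma measurable_maximum X x : measurable (maximum X x : set borel_order).
Proof.
have -> : maximum X x =
    \bigcap_(y in [set` X] `\` [set x]) [set xi : total_order | xi y x].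
  apply/seteqP; split=> xi /= H y; last by move=> yX /eqP yx; apply: H.
  by move=> [yX /eqP yx]; exact: H.
by apply: bigcap_measurableType => y _; exact: measurable_lt.
Qed.

Definition swap (x y z : nat) :=
  if z == x then y else if z == y then x else z.

Lemma swapK x y : involutive (swap x y).
Proof.
move=> z; rewrite /swap; have [->|zx] := eqVneq z x.
  by rewrite eqxx; case: (eqVneq y x).
have [->|zy] := eqVneq z y; first by rewrite eqxx.
by rewrite (negPf zx) (negPf zy).
Qed.

Lemma exists_transposition x y : exists s : Sinf, s^-1%FUN =1 swap x y.
Proof.
have [s fs] := PbijTT (inv_bij (swapK x y)).
exists s => z; apply: (can_inj (swapK x y)); rewrite swapK {1}fs.
by apply: invK; rewrite inE.
Qed.

Definition ascending (x : nat -> nat) (n : nat) : set total_order :=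
  [set xi : total_order | forall i, i < n -> xi (x i) (x i.+1)].

Lemma ascending_lt x n (xi : total_order) i : ascending x n xi ->
  i < n -> xi (x i) (x n).
Proof.
elim: n => // n IHn asc; rewrite ltnS leq_eqVlt => /predU1P[->|ltin].
  exact: asc.
apply: tlt_trans (asc n (ltnSn n)); apply: IHn => // j ltjn.
exact/asc/ltnW.
Qed.

Section Invariant.
Context {R : realType} (mu : probability borel_order R).
Hypothesis hmu : glasner_weiss mu.
Local Open Scope ereal_scope.

(** The transposition of [x] and [y] preserves [X], and it exchanges the two
    events. *)
Lemma measure_maximum_eq X x y : x \in X -> y \in X ->
  mu (maximum X x) = mu (maximum X y).
Proof.
move=> xX yX; have [s sE] := exists_transposition x y.
rewrite -(hmu s (measurable_maximum X x)); congr (mu _).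
have sK z : s^-1%FUN (s^-1%FUN z) = z by rewrite !sE swapK.
have sX z : z \in X -> s^-1%FUN z \in X.
  by rewrite sE /swap => zX; case: ifP => // _; case: ifP.
have sx : s^-1%FUN x = y by rewrite sE /swap eqxx.
apply/seteqP; split=> xi H z zX zne; last first.
  rewrite /= /act_rel sx; apply: H; first exact: sX.
  by apply: contra zne => /eqP zy; rewrite -[z]sK zy -sx sK.
have := H _ (sX _ zX); rewrite /= /act_rel sK sx; apply.
by apply: contra zne => /eqP zx; rewrite -[z]sK zx sx.
Qed.

(** The elements of a finite set are equally likely to be its maximum, and at
    most one of them is. *)
Lemma measure_maximum X x : uniq X -> x \in X ->
  mu (maximum X x) <= ((size X)%:R^-1)%:E.
Proof.
move=> uX xX.
have X0 : (0 < size X)%N by case: (X) xX.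
have triv : trivIset [set` X] (maximum X).
  move=> y z /= yX zX [xi [ymax zmax]]; apply/eqP/negP => /negP nyz.
  have := tlt_irr xi y.
  by rewrite (tlt_trans (zmax _ yX nyz) (ymax _ zX _)) 1?eq_sym.
have : mu (\bigcup_(y in [set` X]) maximum X y) <= 1.
  apply: probability_le1; apply: fin_bigcup_measurable; first exact: finite_seq.
  by move=> y _; exact: measurable_maximum.
rewrite (measure_fin_bigcup mu (finite_seq X) triv
  (fun y _ => measurable_maximum X y)).
rewrite -fsbig_seq//= (eq_big_seq (fun=> mu (maximum X x))); last first.
  by move=> y yX; exact: measure_maximum_eq.
have fmu : mu (maximum X x) \is a fin_num.
  by apply: fin_num_measure; exact: measurable_maximum.
rewrite -(fineK fmu) sumEFin big_const_seq count_predT iter_addr addr0 !lee_fin.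
by rewrite -[_^-1%R]div1r ler_pdivlMr ?ltr0n// mulr_natr.
Qed.

(** An ascending [xi] has [x n] as the maximum of the first [n + 1] terms; this
    weakening of [1 / (n + 1)!] is enough for effective convergence to 0. *)
Lemma measure_ascending x n : injective x ->
  mu (ascending x n) <= (n.+1%:R^-1)%:E.
Proof.
move=> xinj; pose X := map x (iota 0 n.+1).
have uX : uniq X by rewrite map_inj_uniq ?iota_uniq.
have xnX : x n \in X by apply: map_f; rewrite mem_iota /= add0n.
have := measure_maximum uX xnX; rewrite size_map size_iota.
apply: le_trans; apply: le_measure.
- have -> : ascending x n =
      \bigcap_(i in `I_n) [set xi : total_order | xi (x i) (x i.+1)].
    by apply/seteqP; split.
  by rewrite inE; apply: bigcap_measurableType => i _; exact: measurable_lt.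
- rewrite inE; exact: measurable_maximum.
- move=> xi asc y /mapP[i]; rewrite mem_iota /= add0n ltnS leq_eqVlt => + ->.
  by case/predU1P=> [->|ltin _]; [rewrite eqxx | exact: ascending_lt].
Qed.

End Invariant.

(** * A recursive chain in the universal poset *)

Section Chain.
Variable prec : rel nat.
Hypotheses (hP : universal_poset prec) (hprec : recursive_rel prec).

(** Up to an automorphism [x] is the bottom of a chain of [x + 2] elements,
    which do not fit into [0, ..., x]. *)
Lemma exists_gap x : exists d, prec x (x + d.+1).
Proof.
have [f [finj fmono]] := up_embeds hP 'I_x.+2.
have bij : set_bij [set f ord0] [set x] (fun=> x).
  split=> [y|y z|y] /=; first by [].
  + by rewrite !inE => -> ->.
  + by move=> ->; exists (f ord0).
have [y z -> ->|s [saut s0]] := up_homogeneous hP (finite_set1 _)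
  (finite_set1 _) bij; first by rewrite !up_irr.
have sinj : injective s by move=> y z; apply: 'inj_s; rewrite inE.
have xlt (i : 'I_x.+2) : i != ord0 -> prec x (s (f i)).
  rewrite -[X in prec X _](s0 (f ord0) erefl) saut fmono lt_def.
  by move=> ->; exact: leq0n.
have [d xd] : exists d, x + d.+1 \in map (s \o f) (enum 'I_x.+2).
  apply: contrapT => /forallNP none.
  have /uniq_leq_size : uniq (map (s \o f) (enum 'I_x.+2)).
    by rewrite map_inj_uniq ?enum_uniq//; exact: inj_comp.
  move=> /(_ (iota 0 x.+1)); rewrite size_map size_enum_ord size_iota ltnn.
  move=> sub.
  suff /sub : {subset map (s \o f) (enum 'I_x.+2) <= iota 0 x.+1} by [].
  move=> y yin; rewrite mem_iota /= add0n ltnS leqNgt; apply/negP => ltxy.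
  by apply: (none (y - x.+1)); rewrite addnS -addSn subnKC.
exists d; move: xd => /mapP[i _ /= xdE]; rewrite xdE; apply: xlt.
apply/eqP => i0; move: xdE; rewrite i0 (s0 (f ord0) erefl); lia.
Qed.

Definition gap x := ex_minn (exists_gap x).

Lemma prec_gap x : prec x (x + (gap x).+1).
Proof. by rewrite /gap; case: ex_minnP. Qed.

Lemma recursive1_gap : recursive1 gap.
Proof.
apply: (@recursive1_min (fun k x => (prec x (x + k.+1) : nat) == 0)).
- apply/recursive2_nth/(recursive_comp1 recursive1_is0).
  apply: (recursive_comp2 hprec); first exact: recursive_nth.
  apply: (recursive_comp2 recursive2_addn); first exact: recursive_nth.
  exact/(recursive_comp1 recursive1S)/recursive_nth.
- by move=> x; rewrite prec_gap.
- move=> x k; rewrite /gap; case: ex_minnP => m _ mmin ltkm.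
  by case: (boolP (prec _ _)) => // /mmin; rewrite leqNgt ltkm.
Qed.

Definition chain k := iter k (fun x => x + (gap x).+1) 0.

Lemma chain_inj : injective chain.
Proof.
have lt_chain : {homo chain : i j / i < j}.
  apply: homo_ltn => [|i]; first exact: ltn_trans.
  by rewrite /= addnS ltnS leq_addr.
by move=> i j eqij; case: (ltngtP i j) => // /lt_chain; rewrite eqij ltnn.
Qed.

Lemma recursive1_chain : recursive1 chain.
Proof.
apply: (@recursive1_prec 0 (fun _ x => x + (gap x).+1)) => //.
apply/recursive2_nth/(recursive_comp2 recursive2_addn).
  exact: recursive_nth.
apply: (recursive_comp1 recursive1S).
exact/(recursive_comp1 recursive1_gap)/recursive_nth.
Qed.

(** The clause stating that [chain 0, ..., chain n] ascends; the most recent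
    comparison comes first, since recursion can only add in front. *)
Definition chain_clause n : seq nat :=
  iteri n (fun i c => code [:: chain i; gap (chain i)] :: c) [::].

Definition chain_code n := code (map code [:: chain_clause n]).

Lemma all_chain_clause xi n : all (holds xi) (chain_clause n.+1) =
  xi (chain n) (chain n.+1) && all (holds xi) (chain_clause n).
Proof. by rewrite -holds_pair. Qed.

Lemma chain_codeE n : expr_set (dnf (chain_code n)) = ascending chain n.
Proof.
apply/seteqP; split=> xi; rewrite expr_set_dnf /satisfies [has _ _]orbF.
  elim: n => [_ i //|n IHn]; rewrite all_chain_clause => /andP[xn /IHn asc] i.
  by rewrite ltnS leq_eqVlt => /predU1P[->|/asc].
elim: n => // n IHn asc; rewrite all_chain_clause asc// IHn// => i ltin.
exact/asc/ltnW.
Qed.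

Lemma recursive1_chain_code : recursive1 chain_code.
Proof.
have rclause : recursive1 (fun n => code (chain_clause n)).
  apply: (@recursive1_prec 0 (fun n c =>
    code (code (chain n :: decode (code (gap (chain n) :: decode 0)))
          :: decode c))) => [||n]; last by rewrite !codeK.
    apply/recursive2_nth/(recursive_comp2 recursive2_cons); last first.
      exact: recursive_nth.
    have rc : @recursive 2 (fun t => chain (nth 0 t 0)).
      exact/(recursive_comp1 recursive1_chain)/recursive_nth.
    apply: (recursive_comp2 recursive2_cons) => //.
    apply: (recursive_comp2 recursive2_cons); last exact: recursive_const.
    exact: (recursive_comp1 recursive1_gap).
  by [].
apply: recursive1_nth; apply: (eq_recursive (f := fun t : 1.-tuple nat =>
  code (code (chain_clause (nth 0 t 0)) :: decode 0))) => //.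
apply: (recursive_comp2 recursive2_cons); last exact: recursive_const.
exact/(recursive_comp1 rclause)/recursive_nth.
Qed.

End Chain.

(** * The linear extensions form a constructive null set *)

Lemma constructive_null_linear_extensions (R : realType)
    (mu : probability borel_order R) prec :
  glasner_weiss mu -> universal_poset prec -> recursive_rel prec ->
  constructive_null mu (linear_extension prec).
Proof.
move=> hmu hP hprec; exists (expr_set \o dnf).
split; first exact: representation_dnf.
exists (fun n _ => chain_code hP n); split.
  by apply/recursive2_nth/(recursive_comp1 (recursive1_chain_code hP hprec));
    exact: recursive_nth.
split.
  move=> xi ext n _; exists 0 => //=; rewrite chain_codeE => i _.
  exact/ext/prec_gap.
exists (fun k => 2 ^ k); split.
  (* [2 ^ k] is the code of [:: k]. *)
  apply: recursive1_nth; apply: (eq_recursive (f := fun t : 1.-tuple nat =>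
    code (nth 0 t 0 :: decode 0))) => [t|]; first by rewrite /= muln1.
  apply: (recursive_comp2 recursive2_cons); last exact: recursive_const.
  exact: recursive_nth.
move=> k n le2kn; rewrite bigcup_const; last by exists 0.
rewrite /= chain_codeE; apply: le_lt_trans.
  exact/measure_ascending/chain_inj.
by rewrite lte_fin -natrX ltf_pV2 ?posrE ?ltr0n ?expn_gt0// ltr_nat ltnS.
Qed.

Lemma linear_extension_act prec (s : Sinf) xi : automorphism prec s ->
  linear_extension prec xi -> linear_extension prec (act s xi).
Proof.
move=> saut ext x y xy; apply: ext; rewrite -saut.
by rewrite !invK ?inE.
Qed.

Theorem theorem7 (R : realType) (mu : probability borel_order R)
    (hmu : glasner_weiss mu)
    (prec : rel nat) (hP : universal_poset prec) (hprec : recursive_rel prec)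
    (eta : total_order) (heta : recursive_rel eta)
    (hQ : rational_order eta) (hext : linear_extension prec eta)
    (sigma : Sinf) (hsigma : randomizers mu eta sigma) :
  ~ automorphism prec sigma.
Proof.
move=> saut; apply: (hsigma (linear_extension prec)).
- exact: constructive_null_linear_extensions.
- exact: linear_extension_act.
Qed.
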